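(* Let $n,d\in\mathbb{N}$ with $d\mid n$, and let $\chi$ be a Dirichlet character (mod $n$) with conductor $d$. Let $f:\mathbb{Z}\to\mathbb{C}$ be an even function (mod $n$) and let $s\in\mathbb{Z}$. Then $$\sum_{k=1}^n f(k-s)\,\chi(k)=\varphi(n)\,\chi^*(s)\sum_{\substack{\delta\mid n/d\\ (\delta,s)=1}}\frac{(\mu*f)(\delta d)}{\varphi(\delta d)},$$ where $\chi^*$ is the primitive character (mod $d$) that induces $\chi$.
   Context: $\mathbb{N}$ is the set of positive integers. $(a,b)$ denotes the greatest common divisor (nonnegative, with $(0,n)=n$ for $n\in\mathbb{N}$). For fixed $n\in\mathbb{N}$, a function $f:\mathbb{Z}\to\mathbb{C}$ is called an even function (mod $n$) if $f((k,n))=f(k)$ for every $k\in\mathbb{Z}$. $\varphi$ is Euler's totient function, $\mu$ is the Möbius function, and $*$ is Dirichlet convolution of arithmetic functions, so $(\mu*f)(e)=\sum_{ab=e}\mu(a)f(b)$, the sum being over positive integers $a,b$ with $ab=e$ (here $f$ is restricted to positive integers). The primitive character $\chi^*$ (mod $d$) inducing $\chi$ is the unique primitive Dirichlet character (mod $d$) such that $\chi(k)=\chi^*(k)$ if $(k,n)=1$ and $\chi(k)=0$ if $(k,n)>1$. Sums over $\delta\mid n/d$ are over positive divisors. *)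

(* Defs.v *)
From mathcomp Require Import all_boot all_order all_algebra.
From mathcomp Require Import reals complex.

Set Implicit Arguments.
Unset Strict Implicit.
Unset Printing Implicit Defensive.

Import GRing.Theory.
Local Open Scope ring_scope.

Definition even_mod (T : Type) (n : nat) (f : int -> T) : Prop :=
  forall k : int, f (gcdz k n%:Z) = f k.

Record dirichlet_character (C : nzRingType) (n : nat) (chi : int -> C) : Prop :=
  DirichletCharacter {
    dchar_periodic : forall k, chi (k + n%:Z) = chi k;
    dcharM : forall k l, chi (k * l) = chi k * chi l;
    dchar_eq0 : forall k, chi k = 0 <-> ~~ coprimez k n%:Z
  }.

(* Apostol's induced modulus: chi is trivial on the k coprime to n that are
   1 mod d. The conductor is the smallest induced modulus, and chi mod n is
   primitive when n is its only induced modulus. *)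
Definition induced_modulus (C : nzRingType) (n : nat) (chi : int -> C)
    (d : nat) : Prop :=
  (d %| n)%N /\
  forall k : int, coprimez k n%:Z -> (k = 1 %[mod d%:Z])%Z -> chi k = 1.

Definition has_conductor (C : nzRingType) (n : nat) (chi : int -> C)
    (d : nat) : Prop :=
  induced_modulus n chi d /\
  forall e : nat, induced_modulus n chi e -> (d <= e)%N.

Definition primitive_character (C : nzRingType) (n : nat) (chi : int -> C) :
    Prop :=
  dirichlet_character n chi /\ has_conductor n chi n.

Definition induces (C : nzRingType) (n : nat) (chi chistar : int -> C) : Prop :=
  forall k : int, chi k = if coprimez k n%:Z then chistar k else 0.

(* The value at 0 is irrelevant. *)
Definition moebius (n : nat) : int :=
  if all (fun p => logn p n == 1%N) (primes n) then (-1) ^+ size (primes n)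
  else 0.

(* The pairs (a, b) of positive integers with a * b = e are the (a, e %/ a)
   for a dividing e > 0; the value at e = 0 is irrelevant. *)
Definition dirichlet_conv (C : nzRingType) (g h : nat -> C) (e : nat) : C :=
  \sum_(a <- divisors e) g a * h (e %/ a)%N.

(* Main.v *)
(* By Moebius inversion f (k - s) is the sum of (mu * f)(e) over the common
   divisors e of n and k - s, so the theorem reduces to the sums of chi over the
   residue classes s mod e. Such a sum vanishes unless s is prime to e and d
   divides e: multiplying k by a unit m = 1 mod e multiplies the sum by chi m,
   so a nonzero sum makes e an induced modulus, hence a multiple of d. In the
   remaining case chi takes only the values chistar s and 0 on the class, which
   contains totient n / totient e residues prime to n. *)
Require Import Defs.
From mathcomp Require Import all_boot all_order all_algebra.
From mathcomp Require Import reals complex.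
From mathcomp Require Import ring.

Set Implicit Arguments.
Unset Strict Implicit.
Unset Printing Implicit Defensive.

Import GRing.Theory.
Local Open Scope ring_scope.

(** * Sums over divisors and Moebius inversion *)

Lemma big_divisors_dvd (V : nmodType) (m n : nat) (F : nat -> V) :
  (0 < n)%N -> (m %| n)%N ->
  \sum_(e <- divisors m) F e = \sum_(e <- divisors n | (e %| m)%N) F e.
Proof.
move=> n_gt0 m_n; have m_gt0 := dvdn_gt0 n_gt0 m_n.
rewrite -[RHS]big_filter; apply: perm_big.
apply: uniq_perm; rewrite ?filter_uniq ?divisors_uniq// => e.
rewrite mem_filter -!dvdn_divisors//; case: (boolP (e %| m)%N) => //= e_m.
by rewrite (dvdn_trans e_m m_n).
Qed.

Lemma big_divisors_mull (V : nmodType) (d n : nat) (P : pred nat)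
    (F : nat -> V) :
  (0 < n)%N -> (d %| n)%N ->
  \sum_(e <- divisors n | (d %| e)%N && P e) F e =
  \sum_(c <- divisors (n %/ d) | P (c * d)%N) F (c * d)%N.
Proof.
move=> n_gt0 d_n; have d_gt0 := dvdn_gt0 n_gt0 d_n.
rewrite -(big_map (fun c => c * d)%N P) -big_filter_cond; apply: perm_big.
have q_gt0 : (0 < n %/ d)%N by rewrite divn_gt0// dvdn_leq.
apply: uniq_perm; rewrite ?filter_uniq ?map_inj_uniq ?divisors_uniq//.
  by move=> a b /eqP; rewrite eqn_pmul2r// => /eqP.
move=> e; rewrite mem_filter -!dvdn_divisors//; apply/andP/mapP.
  case=> /dvdnP[c ->] cd_n; exists c => //.
  by rewrite -dvdn_divisors// dvdn_divRL.
by case=> c + ->; rewrite -dvdn_divisors// dvdn_divRL// dvdn_mull.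
Qed.

(** If [p] divides [b], its exponent in [p * b] is at least 2; otherwise [p] is one new prime and
    the other exponents are unchanged. *)
Lemma moebius_prime_mull (p b : nat) : prime p -> (0 < b)%N ->
  moebius (p * b) = if (p %| b)%N then 0 else - moebius b.
Proof.
move=> p_pr b_gt0; have p_gt0 := prime_gt0 p_pr.
have pb_gt0 : (0 < p * b)%N by rewrite muln_gt0 p_gt0.
rewrite /moebius; case: (boolP (p %| b)%N) => p_b.
  case: ifP => // all_pb; have := allP all_pb p.
  rewrite primesM// primes_prime// inE eqxx => /(_ isT).
  rewrite lognM// logn_prime// eqxx add1n eqSS -leqn0 leqNgt.
  by rewrite logn_gt0 mem_primes p_pr b_gt0 p_b.
have pNb : p \notin primes b by rewrite mem_primes p_pr b_gt0.
have perm_pb : perm_eq (primes (p * b)) (p :: primes b).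
  apply: uniq_perm; rewrite /= ?primes_uniq ?pNb// => q.
  by rewrite primesM// primes_prime// !inE.
rewrite (perm_size perm_pb) (perm_all _ perm_pb) /=.
rewrite lognM// logn_prime// eqxx logn_coprime ?prime_coprime ?p_b//=.
rewrite (eq_in_all (a2 := fun q => logn q b == 1%N)).
  by case: ifP; rewrite ?oppr0// exprS mulN1r.
move=> q q_b; rewrite lognM// logn_prime//.
by case: (eqVneq q p) => [qp|]//; rewrite qp (negPf pNb) in q_b.
Qed.

(** For a prime [p] dividing [n], the terms at [a] and [p * a] with [a] prime to [p] cancel, and the
    terms at multiples of [p ^ 2] vanish. *)
Lemma sum_moebius (n : nat) : (0 < n)%N ->
  \sum_(a <- divisors n) moebius a = (n == 1%N)%:R.
Proof.
move=> n_gt0; have [->|n_neq1] := eqVneq n 1%N.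
  by rewrite big_seq1.
have n_gt1 : (1 < n)%N by case: n n_gt0 n_neq1 => [|[]].
set p := pdiv n; have p_pr : prime p := pdiv_prime n_gt1.
have p_n : (p %| n)%N := pdiv_dvd n.
have p_gt0 := prime_gt0 p_pr.
have np_gt0 : (0 < n %/ p)%N by rewrite divn_gt0// dvdn_leq.
rewrite (bigID (fun a => p %| a)%N)/=.
under eq_bigl do rewrite -[(p %| _)%N]andbT.
rewrite (big_divisors_mull predT)//.
under eq_big_seq => a.
  rewrite -dvdn_divisors// => a_n.
  rewrite mulnC moebius_prime_mull ?(dvdn_gt0 np_gt0)//.
  over.
rewrite (big_divisors_dvd _ n_gt0 (dvdn_div p_n)).
rewrite [X in X + _]big_mkcond [X in _ + X]big_mkcond /= -big_split /=.
rewrite big_seq big1// => a; rewrite -dvdn_divisors// => a_n.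
case: (boolP (p %| a)%N) => p_a /=; first by case: ifP; rewrite addr0.
rewrite dvdn_divRL// mulnC Gauss_dvd ?prime_coprime// p_n a_n /=.
by rewrite addNr.
Qed.

Lemma moebius_inversion (C : nzRingType) (f : nat -> C) (n : nat) :
  (0 < n)%N ->
  \sum_(e <- divisors n) dirichlet_conv (fun a => (moebius a)%:~R) f e = f n.
Proof.
move=> n_gt0; rewrite /dirichlet_conv.
transitivity (\sum_(e <- divisors n) \sum_(a <- divisors n | (a %| e)%N)
   (moebius a)%:~R * f (e %/ a)%N).
  apply: eq_big_seq => e; rewrite -dvdn_divisors// => e_n.
  by rewrite (big_divisors_dvd _ n_gt0 e_n).
rewrite (exchange_big_dep predT)//=.
(* Writing [e = c * a] lets the sum over [a] be taken first: [f c] then has as coefficient the sum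
   of [moebius] over the divisors of [n %/ c], which is 0 unless [c = n]. *)
transitivity (\sum_(a <- divisors n) \sum_(c <- divisors n | (c * a %| n)%N)
   (moebius a)%:~R * f c).
  apply: eq_big_seq => a; rewrite -dvdn_divisors// => a_n.
  have a_gt0 := dvdn_gt0 n_gt0 a_n.
  under eq_bigl do rewrite -[(a %| _)%N]andbT.
  rewrite (big_divisors_mull predT)//=.
  rewrite (big_divisors_dvd _ n_gt0 (dvdn_div a_n)).
  by apply: eq_big => c; rewrite ?dvdn_divRL ?mulnK.
rewrite (exchange_big_dep predT)//=.
transitivity (\sum_(c <- divisors n) (n == c)%:R * f c).
  apply: eq_big_seq => c; rewrite -dvdn_divisors// => c_n.
  have c_gt0 := dvdn_gt0 n_gt0 c_n.
  have q_gt0 : (0 < n %/ c)%N by rewrite divn_gt0// dvdn_leq.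
  under eq_bigl do rewrite mulnC -dvdn_divRL//.
  rewrite -mulr_suml -(big_divisors_dvd _ n_gt0 (dvdn_div c_n)).
  rewrite -(rmorph_sum intr) sum_moebius// eq_sym eqn_div// mul1n.
  by rewrite rmorph_nat eq_sym.
rewrite (bigD1_seq n) ?divisors_uniq -?dvdn_divisors//= eqxx mul1r.
by rewrite big1 ?addr0// => c; rewrite eq_sym => /negPf->; rewrite mul0r.
Qed.

(** * Periodic functions and units modulo [n] *)

Lemma periodic_eqmod (T : Type) (n : nat) (F : int -> T) (k l : int) :
  (forall k, F (k + n%:Z) = F k) -> (n%:Z %| k - l)%Z -> F k = F l.
Proof.
move=> perF /dvdzP[q kl].
have perFn (m : nat) x : F (x + m%:Z * n%:Z) = F x.
  elim: m => [|m IHm]; first by rewrite mul0r addr0.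
  by rewrite -addn1 PoszD mulrDl mul1r addrA perF.
case: q kl => m kl.
  by rewrite -[k](subrK l) kl addrC perFn.
rewrite -[LHS](perFn m.+1) (_ : k + _ = l)//.
by rewrite -[k](subrK l) kl NegzE mulNr addrAC addNr add0r.
Qed.

(** Multiplication by a unit permutes the residues mod [n]; [h] is this permutation. *)
Lemma sum_periodic_mull (V : nmodType) (n : nat) (F : int -> V) (m : int) :
  (0 < n)%N -> (forall k, F (k + n%:Z) = F k) -> coprimez m n%:Z ->
  \sum_(i < n) F (m * i%:Z) = \sum_(i < n) F i%:Z.
Proof.
case: n => // n _ perF co_mn; pose h (i : 'I_n.+1) : 'I_n.+1 :=
  inord `|(m * i%:Z %% n.+1%:Z)%Z|%N.
have hE i : (h i)%:Z = (m * i%:Z %% n.+1%:Z)%Z.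
  have ge0 : 0 <= (m * i%:Z %% n.+1%:Z)%Z by rewrite modz_ge0.
  rewrite inordK ?gez0_abs// -ltz_nat gez0_abs//.
  by rewrite ltz_pmod.
have h_inj : injective h.
  move=> i j /(congr1 (fun k : 'I_n.+1 => k%:Z)); rewrite !hE => /eqP.
  rewrite eqz_mod_dvd -mulrBr Gauss_dvdzr 1?coprimez_sym// -eqz_mod_dvd.
  by rewrite !modz_nat !modn_small// => /eqP[] /val_inj.
rewrite [RHS](reindex_inj h_inj); apply: eq_bigr => i _ /=.
by apply: (periodic_eqmod perF); rewrite hE -eqz_mod_dvd modz_mod.
Qed.

Lemma coprimez_eqmod (n : nat) (k l : int) :
  (n%:Z %| k - l)%Z -> coprimez k n%:Z = coprimez l n%:Z.
Proof.
rewrite -eqz_mod_dvd => /eqP kl.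
by rewrite /coprimez -gcdz_modl kl gcdz_modl.
Qed.

Lemma coprimez_lift (e n : nat) (s : int) : (0 < n)%N -> coprimez s e%:Z ->
  exists2 x, coprimez x n%:Z & (e%:Z %| x - s)%Z.
Proof.
move=> n_gt0 co_se.
(* For a prime p dividing n, exactly one of s and t * e is divisible by p. *)
pose t := (\prod_(p <- primes n | ~~ (p %| `|s|)) p)%N.
exists (s + t%:Z * e%:Z); last by rewrite addrC addKr dvdz_mull.
rewrite coprimezE /coprime; apply: contraT => g_neq1.
set g := gcdn _ _ in g_neq1; set p := pdiv g.
have p_pr : prime p.
  by apply: pdiv_prime; rewrite ltn_neqAle eq_sym g_neq1 gcdn_gt0 n_gt0 orbT.
have p_n : (p %| n)%N := dvdn_trans (pdiv_dvd g) (dvdn_gcdr _ _).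
have : (p%:Z %| s + t%:Z * e%:Z)%Z.
  exact: dvdn_trans (pdiv_dvd g) (dvdn_gcdl _ _).
have p_t : (p %| t)%N = ~~ (p %| `|s|)%N.
  rewrite /t -big_filter; apply/idP/idP => [|pNs].
    rewrite Euclid_dvd_prod// big_has => /hasP[q];
      rewrite mem_filter => /andP[qNs].
    by rewrite mem_primes => /andP[q_pr _]; rewrite dvdn_prime2// => /eqP->.
  rewrite (big_rem p) ?dvdn_mulr//= mem_filter pNs.
  by rewrite mem_primes p_pr n_gt0.
have [p_s|pNs] := boolP (p%:Z %| s)%Z.
  rewrite rpredDl// dvdzE abszM Euclid_dvdM//= p_t.
  rewrite -[(p %| `|s|)%N]/(p%:Z %| s)%Z p_s /= => p_e.
  have : (p%:Z %| gcdz s e%:Z)%Z by rewrite dvdz_gcd p_s.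
  by rewrite (eqP co_se) dvdz1 => /eqP p1; move: p_pr; rewrite [p]p1.
rewrite rpredDr ?(negPf pNs)// dvdz_mulr//.
by rewrite -[(_ %| _)%Z]/(p %| t)%N p_t.
Qed.

(** * Induced moduli and the conductor *)

Lemma induced_modulus_gcd (C : nzRingType) (n d e : nat) (chi : int -> C) :
  (0 < n)%N -> dirichlet_character n chi -> induced_modulus n chi d ->
  induced_modulus n chi e -> induced_modulus n chi (gcdn d e).
Proof.
move=> n_gt0 [chi_per chiM chi0] [d_n chi_d] [e_n chi_e].
split=> [|k co_kn /eqP]; first exact: dvdn_trans (dvdn_gcdl d e) d_n.
rewrite eqz_mod_dvd => /dvdzP[q kE].
have [u [v uvE]] := Bezoutz d%:Z e%:Z; rewrite /gcdz /= in uvE.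
(* Chinese remaindering for moduli that agree on their gcd: since [k - 1 = q * (u * d + v * e)],
   this [x] also equals [k - q * v * e]. *)
pose x := 1 + q * u * d%:Z.
have xd : (d%:Z %| x - 1)%Z by rewrite addrC addKr dvdz_mull.
have xe : (e%:Z %| x - k)%Z.
  apply/dvdzP; exists (- (q * v)); rewrite /x.
  have -> : k = q * (u * d%:Z + v * e%:Z) + 1 by rewrite uvE -kE subrK.
  ring.
(* Lifting from the modulus [d * e] makes [y] prime to [n] while keeping both congruences of [x]. *)
have co_xde : coprimez x (d * e)%N%:Z.
  rewrite PoszM coprimezMr (coprimez_eqmod xd) (coprimez_eqmod xe) /=.
  by rewrite {1}/coprimez gcd1z eqxx (coprimez_dvdr _ co_kn).
have [y co_yn y_x] := coprimez_lift n_gt0 co_xde.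
have yd : (d%:Z %| y - 1)%Z.
  rewrite -(subrK x y) -addrA rpredD//.
  by apply: dvdz_trans y_x; rewrite dvdzE dvdn_mulr.
have ye : (e%:Z %| y - k)%Z.
  rewrite -(subrK x y) -addrA rpredD//.
  by apply: dvdz_trans y_x; rewrite dvdzE dvdn_mull.
(* [w] inverts [y] mod [n], so [chi w = 1]; as [y = k] mod [e], also [w * k = 1] mod [e], and hence
   [chi k = chi (w * k) = 1]. *)
have /coprimezP[[w z] /= wzE] := co_yn.
have wy1 : (n%:Z %| w * y - 1)%Z.
  by apply/dvdzP; exists (- z); rewrite -wzE; ring.
have chi1 : chi 1 = 1 by apply: chi_d; rewrite // /coprimez gcd1z.
have chiy : chi y = 1 by apply: chi_d => //; apply/eqP; rewrite eqz_mod_dvd.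
have chiw : chi w = 1.
  by rewrite -[LHS](mulr1 (chi w)) -{1}chiy -chiM (periodic_eqmod chi_per wy1).
have co_wn : coprimez w n%:Z.
  by have := coprimez_eqmod wy1;
    rewrite coprimezMl /coprimez gcd1z eqxx => /andP[].
rewrite -[LHS]mul1r -{1}chiw -chiM; apply: chi_e;
  first by rewrite coprimezMl co_wn.
apply/eqP; rewrite eqz_mod_dvd.
have -> : w * k - 1 = (w * y - 1) - w * (y - k) by ring.
rewrite rpredB ?dvdz_mull//; exact: dvdz_trans wy1.
Qed.

(** The gcd of [d] and [e] is again an induced modulus, so minimality of [d] forces it to equal
    [d]. *)
Lemma conductor_dvd (C : nzRingType) (n d e : nat) (chi : int -> C) :
  (0 < n)%N -> dirichlet_character n chi -> has_conductor n chi d ->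
  induced_modulus n chi e -> (d %| e)%N.
Proof.
move=> n_gt0 chiD [chi_d d_min] chi_e.
have d_gt0 : (0 < d)%N := dvdn_gt0 n_gt0 chi_d.1.
rewrite (_ : d = gcdn d e) ?dvdn_gcdr//; apply/eqP; rewrite eqn_leq.
rewrite [X in _ && X](dvdn_leq d_gt0 (dvdn_gcdl d e)) andbT.
by apply: d_min; apply: induced_modulus_gcd.
Qed.

(** * Character sums over residue classes *)

Lemma induced_modulus_residue_sum (C : idomainType) (n e : nat)
    (chi : int -> C) (s : int) :
  (0 < n)%N -> (e %| n)%N -> dirichlet_character n chi ->
  \sum_(k < n | (e%:Z %| k%:Z - s)%Z) chi k%:Z != 0 ->
  induced_modulus n chi e.
Proof.
move=> n_gt0 e_n [chi_per chiM chi0] S_neq0; split=> // m co_mn m1.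
(* Extended by 0 off the class of [s], the summand is [n]-periodic because [e] divides [n], so [k]
   may be replaced by [m * k]. *)
pose F k := if (e%:Z %| k - s)%Z then chi k else 0.
have perF k : F (k + n%:Z) = F k.
  by rewrite /F chi_per addrAC rpredDr.
apply: (mulIf S_neq0);
  rewrite mul1r big_mkcond /= -[RHS](sum_periodic_mull n_gt0 perF co_mn).
rewrite mulr_sumr; apply: eq_bigr => k _; rewrite /F chiM.
have -> : (e%:Z %| m * k%:Z - s)%Z = (e%:Z %| k%:Z - s)%Z.
  have -> : m * k%:Z - s = (m - 1) * k%:Z + (k%:Z - s) by ring.
  by rewrite [LHS]rpredDl// dvdz_mulr// -eqz_mod_dvd m1.
by case: ifP => //; rewrite mulr0.
Qed.

(** All classes of units mod [e] contain equally many units mod [n]: a unit [y] of [n] lifting [x]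
    carries the class of 1 onto that of [x]. The product form avoids division in [C]. *)
Lemma count_coprime_residue (C : nzRingType) (n e : nat) (s : int) :
  (0 < n)%N -> (e %| n)%N -> coprimez s e%:Z ->
  (\sum_(k < n | (e%:Z %| k%:Z - s)%Z) (coprimez k%:Z n%:Z)%:R) *
    (totient e)%:R = (totient n)%:R :> C.
Proof.
move=> n_gt0 e_n co_se; have e_gt0 := dvdn_gt0 n_gt0 e_n.
pose N s : C := \sum_(k < n | (e%:Z %| k%:Z - s)%Z) (coprimez k%:Z n%:Z)%:R.
have N1 x : coprimez x e%:Z -> N x = N 1.
  move=> co_xe; have [y co_yn yx] := coprimez_lift n_gt0 co_xe.
  pose F k : C := if (e%:Z %| k - x)%Z then (coprimez k n%:Z)%:R else 0.
  have perF k : F (k + n%:Z) = F k.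
    rewrite /F addrAC rpredDr// (@coprimez_eqmod n (k + n) k)//.
    by rewrite addrAC subrr add0r.
  rewrite /N big_mkcond -[LHS](sum_periodic_mull n_gt0 perF co_yn).
  rewrite [RHS]big_mkcond; apply: eq_bigr => k _ /=; rewrite /F.
  rewrite coprimezMl co_yn /=; congr (if _ then _ else _).
  have -> : y * k%:Z - x = y * (k%:Z - 1) + (y - x) by ring.
  rewrite rpredDr// Gauss_dvdzr// coprimez_sym.
  by rewrite (coprimez_eqmod yx).
rewrite -/(N s) N1// !totient_count_coprime !natr_sum !big_mkord mulr_sumr.
(* The classes of non-units mod [e] contain no unit mod [n], so they can be added freely; then each
   [k] lies in exactly one class. *)
transitivity (\sum_(j < e) \sum_(k < n | (e%:Z %| k%:Z - j%:Z)%Z)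
    (coprimez k%:Z n%:Z)%:R : C).
  apply: eq_bigr => j _; rewrite coprime_sym.
  have [co_je|/negPf co_je] := boolP (coprime j e);
    first by rewrite mulr1 -(N1 j%:Z).
  rewrite mulr0 big1// => k kj.
  case: (boolP (coprimez k n)) => // co_kn; move: co_je.
  by rewrite -[coprime j e]/(coprimez j e) -(coprimez_eqmod kj) (coprimez_dvdr
    e_n).
rewrite (exchange_big_dep predT)//=; apply: eq_bigr => k _.
pose j : 'I_e := Ordinal (ltn_pmod k e_gt0).
rewrite (big_pred1 j) => [|i]; first by rewrite coprimezE coprime_sym.
rewrite /= -val_eqE /= -eqz_mod_dvd !modz_nat (modn_small (ltn_ord i)).
by rewrite eqz_nat eq_sym.
Qed.

Lemma char_residue_sum (C : numFieldType) (n d e : nat)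
    (chi chistar : int -> C) (s : int) :
  (0 < n)%N -> (e %| n)%N ->
  dirichlet_character n chi -> has_conductor n chi d ->
  dirichlet_character d chistar -> induces n chi chistar ->
  \sum_(k < n | (e%:Z %| k%:Z - s)%Z) chi k%:Z =
  if (d %| e)%N && coprimez s e%:Z
  then (totient n)%:R / (totient e)%:R * chistar s else 0.
Proof.
move=> n_gt0 e_n chiD chi_d [star_per _ _] chiE.
have e_gt0 := dvdn_gt0 n_gt0 e_n.
case: (boolP (coprimez s e)) => [co_se|/negPf co_se]; last first.
  rewrite andbF big1// => k ks; rewrite chiE; case: ifP => // co_kn.
  by move: co_se; rewrite -(coprimez_eqmod ks) (coprimez_dvdr e_n).
rewrite andbT; case: ifP => [d_e|dNe]; last first.
  apply/eqP; apply: contraFT dNe => S_neq0.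
  exact: (conductor_dvd n_gt0 chiD chi_d (induced_modulus_residue_sum _ _ chiD
    S_neq0)).
rewrite -(count_coprime_residue C n_gt0 e_n co_se) mulfK ?mulr_suml; last first.
  by rewrite Num.Theory.pnatr_eq0 -lt0n totient_gt0.
apply: eq_bigr => k ks; rewrite chiE.
(* Since [d] divides [e], [chistar] is constant on the class. *)
have <- : chistar k = chistar s.
  by apply: (periodic_eqmod star_per); apply: dvdz_trans ks.
by case: ifP; rewrite ?mul1r ?mul0r.
Qed.

Theorem theorem2p4 (R : realType) (n d : nat) (chi chistar : int -> R[i])
    (f : int -> R[i]) (s : int) :
  (0 < n)%N -> (0 < d)%N -> (d %| n)%N ->
  dirichlet_character n chi ->
  has_conductor n chi d ->
  primitive_character d chistar ->
  induces n chi chistar ->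
  even_mod n f ->
  \sum_(1 <= k < n.+1) f (k%:Z - s) * chi k%:Z =
  (totient n)%:R * chistar s *
    \sum_(delta <- divisors (n %/ d) | coprimez delta%:Z s)
      dirichlet_conv (fun a : nat => (moebius a)%:~R) (fun b : nat => f b%:Z)
        (delta * d)%N / (totient (delta * d))%:R.
Proof.
move=> n_gt0 d_gt0 d_n chiD chi_d [starD _] chiE f_even.
set g := dirichlet_conv _ _.
(* Evenness replaces [k] by its gcd with [n], which is positive even for [k = 0], so Moebius
   inversion applies. *)
have fE k : f k = \sum_(e <- divisors n | (e%:Z %| k)%Z) g e.
  have m_n : (`|gcdz k n| %| n)%N by exact: dvdn_gcdr.
  have m_gt0 := dvdn_gt0 n_gt0 m_n.
  rewrite -f_even -[gcdz k n]/(`|gcdz k n|%:Z).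
  rewrite -(moebius_inversion (fun b => f b%:Z) m_gt0) (big_divisors_dvd _
    n_gt0 m_n).
  rewrite big_seq_cond [RHS]big_seq_cond; apply: eq_bigl => e.
  case: (boolP (e \in _)) => //=; rewrite -dvdn_divisors// => e_n.
  by rewrite -[(e %| _)%N]/(e%:Z %| gcdz k n)%Z dvdz_gcd [(e%:Z %| n%:Z)%Z]e_n
    andbT.
(* The term at [k = n] equals the one at [k = 0]: [chi] has period [n], and so has [f], being a
   function of the gcd with [n]. *)
transitivity (\sum_(k < n) f (k%:Z - s) * chi k%:Z).
  rewrite big_nat_recr// -(big_mkord predT (fun k => f (k%:Z - s) * chi k%:Z)).
  rewrite [RHS]big_ltn// [LHS]addrC; congr (_ + _).
  rewrite -[n%:Z]add0r (dchar_periodic chiD) -f_even addrAC gcdzC gcdzDr gcdzC.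
  by rewrite f_even.
transitivity (\sum_(e <- divisors n) g e *
    \sum_(k < n | (e%:Z %| k%:Z - s)%Z) chi k%:Z).
  under eq_bigr do rewrite fE mulr_suml.
  rewrite (exchange_big_dep predT)//=; apply: eq_bigr => e _.
  by rewrite mulr_sumr.
transitivity (\sum_(e <- divisors n | (d %| e)%N && coprimez s e%:Z)
    (totient n)%:R * chistar s * (g e / (totient e)%:R)).
  rewrite [RHS]big_mkcond; apply: eq_big_seq => e; rewrite -dvdn_divisors//
    => e_n.
  rewrite (char_residue_sum s n_gt0 e_n chiD chi_d starD chiE).
  by case: ifP; rewrite ?mulr0// => _; ring.
rewrite (big_divisors_mull (fun e => coprimez s e%:Z))// mulr_sumr.
rewrite big_mkcond [RHS]big_mkcond; apply: eq_bigr => c _ /=.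
(* Coprimality of [s] to [c * d] splits into two conditions; the one on [d] is absorbed by
   [chistar s], which is 0 when it fails. *)
rewrite PoszM coprimezMr coprimez_sym.
case: (boolP (coprimez c s)) => //= _; case: (boolP (coprimez s d)) => // co_sd.
by have [_ _ /(_ s)[_ /(_ co_sd)->]] := starD; rewrite mulr0 mul0r.
Qed.
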